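(* Let $f, h_1,\dots,h_p, g_1,\dots,g_m:\mathbb{R}^n\to\mathbb{R}$ be twice continuously differentiable and consider the problem (NLP) of minimizing $f(x)$ over $x\in\mathbb{R}^n$ subject to $h_j(x)=0$ ($j=1,\dots,p$) and $g_i(x)\le 0$ ($i=1,\dots,m$). Let $\{x^k\}$ be a sequence generated by the basic penalty method for (NLP), and let $x^*$ be any accumulation point of $\{x^k\}$. Suppose that $$\lim_{k\to\infty}\sum_{j=1}^p h_j(x^k)^2=0\quad\text{and}\quad\lim_{k\to\infty}\sum_{i=1}^m\max\{0,g_i(x^k)\}=0.$$ Then $x^*$ is an $\tilde S$-SAKKT2 point, i.e. $x^*$ satisfies the $\tilde S$-SAKKT2 conditions for (NLP).
   Context: Write $h=(h_1,\dots,h_p)$, $g=(g_1,\dots,g_m)$; $\|\cdot\|$ is the Euclidean norm; $\max$ and $\min$ of vectors are taken componentwise. For $x\in\mathbb{R}^n$, $A(x)=\{i\in\{1,\dots,m\}: g_i(x)=0\}$. The Lagrangian is $L(x,\mu,\omega)=f(x)+h(x)^\top\mu+g(x)^\top\omega$ for $x\in\mathbb{R}^n$, $\mu\in\mathbb{R}^p$, $\omega\in\mathbb{R}^m_+$. The notation $\varepsilon_k\searrow 0$ means that the positive scalars $\varepsilon_k$ converge monotonically to $0$. A sequence $\{(x^k,\mu^k,\omega^k,\varepsilon_k)\}\subseteq\mathbb{R}^n\times\mathbb{R}^p\times\mathbb{R}^m_+\times(0,\infty)$ with $x^k\to\bar x$ and $\varepsilon_k\searrow 0$ satisfies AKKT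 (approximate KKT) if for all $k$: (i) $\big\|\nabla f(x^k)+\sum_{j=1}^p\mu_j^k\nabla h_j(x^k)+\sum_{i=1}^m\omega_i^k\nabla g_i(x^k)\big\|\le\varepsilon_k$; (ii) $\|h(x^k)\|\le\varepsilon_k$; (iii) $\|\max\{0,g(x^k)\}\|\le\varepsilon_k$; (iv) $\|\min\{\omega^k,-g(x^k)\}\|\le\varepsilon_k$. $\tilde S$-SAKKT2: $\bar x$ satisfies $\tilde S$-SAKKT2 if there exists a sequence $\{(x^k,\mu^k,\omega^k,\varepsilon_k)\}\subseteq\mathbb{R}^n\times\mathbb{R}^p\times\mathbb{R}^m_+\times(0,\infty)$ (not necessarily the sequences of the algorithm below) with $x^k\to\bar x$, $\varepsilon_k\searrow0$, satisfying AKKT and $d^\top\nabla^2_{xx}L(x^k,\mu^k,\omega^k)d\ge-\varepsilon_k\|d\|^2$ for all $d\in\tilde S(x^k,\bar x,\omega^k)$, where $\tilde S(y,x,\omega)$ is the set of $d\in\mathbb{R}^n$ such that $\nabla h_j(y)^\top d=0$ for $j=1,\dots,p$ and $\nabla g_i(y)^\top d=0$ for $i\in A(x)$ with $\omega_i>0$. Penalty function: for $\rho>0$, $$\phi_\rho(x)=f(x)+\frac{\rho}{2}\sum_{j=1}^p h_j(x)^2+\frac{\rho}{4}\sum_{i=1}^m\max\{0,g_i(x)\}^4 .$$ Basic penalty method: choose sequences $\{\varepsilon_k\},\{\rho_k\}\subset(0,\infty)$ with $\varepsilon_k\searrow0$ and $\rho_k\to\infty$, and an initial point in $\mathbb{R}^n$.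 For each $k=0,1,2,\dots$, find an approximate solution $x^k$ of the unconstrained problem of minimizing $\phi_{\rho_k}$ over $\mathbb{R}^n$ satisfying $$\|\nabla\phi_{\rho_k}(x^k)\|\le\varepsilon_k\quad\text{and}\quad d^\top\nabla^2\phi_{\rho_k}(x^k)d\ge-\varepsilon_k\|d\|^2\ \text{ for all } d\in\mathbb{R}^n .$$ *)

(* Defs.v *)
From HB Require Import structures.
From mathcomp Require Import all_boot all_order all_algebra.
From mathcomp Require Import all_classical all_reals all_analysis.

Set Implicit Arguments.
Unset Strict Implicit.
Unset Printing Implicit Defensive.

Import Order.TTheory GRing.Theory Num.Theory.
Import numFieldNormedType.Exports.

Local Open Scope classical_set_scope.
Local Open Scope ring_scope.

(* Points of R^n are column vectors ['cV[R]_n]. The library norm [`|v|] on them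
   is the sup norm; [enorm] is the Euclidean one. The two induce the same
   topology, so convergence is the library's. *)
Definition dotv (R : realType) (n : nat) (u v : 'cV[R]_n) : R :=
  (u^T *m v) 0 0.

Definition enorm (R : realType) (n : nat) (v : 'cV[R]_n) : R :=
  Num.sqrt (dotv v v).

Definition gradient (R : realType) (n : nat) (f : 'cV[R]_n -> R)
    (x : 'cV[R]_n) : 'cV[R]_n :=
  \col_(i < n) 'D_(delta_mx i 0) f x.

Definition hessian (R : realType) (n : nat) (f : 'cV[R]_n -> R)
    (x : 'cV[R]_n) : 'M[R]_n :=
  \matrix_(i < n, j < n) 'D_(delta_mx j 0) (fun y => 'D_(delta_mx i 0) f y) x.

Definition quad_form (R : realType) (n : nat) (M : 'M[R]_n)
    (d : 'cV[R]_n) : R :=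
  dotv d (M *m d).

(* Differentiability is Frechet differentiability; the directional derivatives
   ['D_v] above are total and carry their usual meaning under [C2_fun]. *)
Definition C2_fun (R : realType) (n : nat) (f : 'cV[R]_n -> R) : Prop :=
  [/\ forall x, differentiable f x,
      forall x, differentiable (gradient f) x
    & continuous (hessian f)].

(* A family of constraints [c_1, ..., c_q] is given as [c : 'I_q -> R^n -> R];
   [cvec c x] is the vector [c(x)]. *)
Definition cvec (R : realType) (n q : nat) (c : 'I_q -> 'cV[R]_n -> R)
    (x : 'cV[R]_n) : 'cV[R]_q :=
  \col_(i < q) c i x.

Definition maxv (R : realType) (n : nat) (u v : 'cV[R]_n) : 'cV[R]_n :=
  \col_(i < n) Num.max (u i 0) (v i 0).

Definition minv (R : realType) (n : nat) (u v : 'cV[R]_n) : 'cV[R]_n :=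
  \col_(i < n) Num.min (u i 0) (v i 0).

Definition active (R : realType) (n m : nat) (g : 'I_m -> 'cV[R]_n -> R)
    (x : 'cV[R]_n) : set 'I_m :=
  [set i | g i x = 0].

Definition lagrangian (R : realType) (n p m : nat) (f : 'cV[R]_n -> R)
    (h : 'I_p -> 'cV[R]_n -> R) (g : 'I_m -> 'cV[R]_n -> R)
    (x : 'cV[R]_n) (mu : 'cV[R]_p) (omega : 'cV[R]_m) : R :=
  f x + dotv (cvec h x) mu + dotv (cvec g x) omega.

Definition decreases_to_0 (R : realType) (eps : nat -> R) : Prop :=
  [/\ forall k, 0 < eps k, nonincreasing_seq eps & eps @ \oo --> (0 : R)].

Definition AKKT (R : realType) (n p m : nat) (f : 'cV[R]_n -> R)
    (h : 'I_p -> 'cV[R]_n -> R) (g : 'I_m -> 'cV[R]_n -> R)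
    (xbar : 'cV[R]_n) (x : nat -> 'cV[R]_n) (mu : nat -> 'cV[R]_p)
    (omega : nat -> 'cV[R]_m) (eps : nat -> R) : Prop :=
  [/\ forall k i, 0 <= omega k i 0,
      x @ \oo --> xbar,
      decreases_to_0 eps
    & forall k,
      [/\ enorm (gradient f (x k)
                 + \sum_(j < p) mu k j 0 *: gradient (h j) (x k)
                 + \sum_(i < m) omega k i 0 *: gradient (g i) (x k)) <= eps k,
          enorm (cvec h (x k)) <= eps k,
          enorm (maxv 0 (cvec g (x k))) <= eps k
        & enorm (minv (omega k) (- cvec g (x k))) <= eps k]].

Definition Stilde (R : realType) (n p m : nat)
    (h : 'I_p -> 'cV[R]_n -> R) (g : 'I_m -> 'cV[R]_n -> R)
    (y x : 'cV[R]_n) (omega : 'cV[R]_m) : set 'cV[R]_n :=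
  [set d | (forall j, dotv (gradient (h j) y) d = 0) /\
           (forall i, active g x i -> 0 < omega i 0 ->
              dotv (gradient (g i) y) d = 0)].

Definition Stilde_SAKKT2 (R : realType) (n p m : nat) (f : 'cV[R]_n -> R)
    (h : 'I_p -> 'cV[R]_n -> R) (g : 'I_m -> 'cV[R]_n -> R)
    (xbar : 'cV[R]_n) : Prop :=
  exists (x : nat -> 'cV[R]_n) (mu : nat -> 'cV[R]_p)
         (omega : nat -> 'cV[R]_m) (eps : nat -> R),
    AKKT f h g xbar x mu omega eps /\
    forall k d, Stilde h g (x k) xbar (omega k) d ->
      - eps k * enorm d ^+ 2 <=
      quad_form (hessian (fun y => lagrangian f h g y (mu k) (omega k)) (x k)) d.

Definition penalty (R : realType) (n p m : nat) (f : 'cV[R]_n -> R)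
    (h : 'I_p -> 'cV[R]_n -> R) (g : 'I_m -> 'cV[R]_n -> R)
    (rho : R) (x : 'cV[R]_n) : R :=
  f x + rho / 2 * \sum_(j < p) h j x ^+ 2
      + rho / 4 * \sum_(i < m) Num.max 0 (g i x) ^+ 4.

(* The initial point of the method does not occur: it imposes no condition on
   the iterates. *)
Definition penalty_method_sequence (R : realType) (n p m : nat)
    (f : 'cV[R]_n -> R) (h : 'I_p -> 'cV[R]_n -> R)
    (g : 'I_m -> 'cV[R]_n -> R) (x : nat -> 'cV[R]_n) : Prop :=
  exists eps rho : nat -> R,
    [/\ decreases_to_0 eps,
        forall k, 0 < rho k,
        rho @ \oo --> +oo,
        forall k, enorm (gradient (penalty f h g (rho k)) (x k)) <= eps k
      & forall k d,
          - eps k * enorm d ^+ 2 <=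
          quad_form (hessian (penalty f h g (rho k)) (x k)) d].

(* Main.v *)
Require Import Defs.
From HB Require Import structures.
From mathcomp Require Import all_boot all_order all_algebra.
From mathcomp Require Import all_classical all_reals all_analysis.
From mathcomp Require Import ring lra.
Import Order.TTheory GRing.Theory Num.Theory.
Import numFieldNormedType.Exports.
Local Open Scope classical_set_scope.
Local Open Scope ring_scope.

Set Implicit Arguments.
Unset Strict Implicit.
Unset Printing Implicit Defensive.


(** The penalty function contains its own multiplier estimates.  With
    mu = rho * h(x) and omega = rho * max(0, g(x))^3, the chain rule gives
    grad phi_rho(x) = grad_x L(x, mu, omega) exactly, and

      d^T (Hess phi_rho(x)) d = d^T (Hess_xx L(x, mu, omega)) d
        + rho * sum_j (grad h_j(x) . d)^2
        + 3 rho * sum_i (max(0, g_i(x)) * grad g_i(x) . d)^2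

    ([quad_form_penalty]).  The two curvature terms vanish for d in the
    perturbed critical subspace at x: the equality terms by definition; the
    term of an active i because either g_i(x) <= 0, so that the factor
    max(0, g_i(x)) is zero, or omega_i > 0, so that grad g_i(x) . d = 0; the
    term of an inactive i because g_i(x) < 0 once x is near the limit
    ([inactive_negative_near], where asymptotic feasibility rules out
    g_i > 0 at the limit).  So the first and second order tests of the penalty
    method are literally the stationarity and curvature conditions of SAKKT2.
    Complementarity comes for free from feasibility, since
    min(omega, -g(x)) = - max(0, g(x)) ([minv_ineq_multiplier]).

    What is left is to make one decreasing tolerance serve all conditions.
    Every residual tends to 0 along the iterates, and the accumulation point is
    approached infinitely often, so for each l some iterate is within 1/(l+1)
    of the limit with all its residuals below 1/(l+1); these iterates, with
    tolerance 1/(l+1), form the required sequence.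

    All derivatives are computed through [has_jet2], a calculus of gradients
    and Hessians closed under sums and under composition with a real function
    of one variable. *)

(** * One-variable calculus *)

(** Along the line t |-> x + t v the composite is a composite of real functions,
    so only the directional derivative of the inner function is required. *)
Lemma is_derive_comp_real (R : realType) (V : normedModType R)
    (c : V -> R) (a : R -> R) (x v : V) (dc da : R) :
  is_derive x v c dc -> is_derive (c x) 1 a da ->
  is_derive x v (a \o c) (da * dc).
Proof.
move=> [cxv <-] [acx <-].
pose line (t : R) := c (t *: v + x).
have line0 : line 0 = c x by rewrite /line scale0r add0r.
have derive_line (b : R -> R) : 'D_1 (b \o line) 0 = 'D_v (b \o c) x.
  rewrite /derive; set q1 := fun t => t^-1 *: _; set q2 := fun t => t^-1 *: _.
  suff -> : q1 = q2 by [].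
  apply/funext => t; rewrite /q1 /q2 /line /=.
  by rewrite addr0 scale0r add0r [_%:A]mulr1.
have line_diff : derivable line 0 1 by apply/(derivable1P c x v).
have a_diff : derivable a (line 0) 1 by rewrite line0.
apply: DeriveDef.
  apply/(derivable1P (a \o c) x v)/derivable1_diffP.
  by apply: (@differentiable_comp _ _ _ _ line a); exact/derivable1_diffP.
rewrite -derive_line -derive1E derive1_comp // !derive1E line0.
by rewrite -(derive_line id).
Qed.

(** At the kink t = 0 the difference quotient of s |-> max(0, s)^(n+2) is exactly
    max(0, s)^(n+1), which is continuous and vanishes there. *)
Lemma is_derive_maxX (R : realType) (n : nat) (t : R) :
  is_derive t (1 : R) (fun s => Num.max 0 s ^+ n.+2)
    (n.+2%:R * Num.max 0 t ^+ n.+1).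
Proof.
have [t0|t0|->] := ltgtP t 0.
- rewrite expr0n mulr0.
  apply: (near_eq_is_derive (f := cst 0)).
    near=> s; rewrite max_l ?expr0n //; near: s.
    exact: (filterS (fun y => @ltW _ _ y 0) (lt_nbhsl t0)).
- apply: (near_eq_is_derive (f := fun s : R => s ^+ n.+2)).
    near=> s; rewrite max_r //; near: s.
    exact: (filterS (fun y => @ltW _ _ 0 y) (lt_nbhsr t0)).
  split; first exact: exprn_derivable.
  by rewrite exp_derive [LHS]mulr1.
- rewrite expr0n mulr0.
  have lim0 : (h^-1 *: (Num.max 0 (h *: (1 : R) + 0) ^+ n.+2 -
      Num.max 0 (0 : R) ^+ n.+2)) @[h --> (0 : R)^'] --> (0 : R).
    rewrite (_ : (fun h : R => _) = fun h => Num.max 0 h ^+ n.+1); last first.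
      apply/funext => h; rewrite maxxx expr0n subr0 addr0 [_%:A]mulr1.
      have [h0|h0] := leP h 0; first by rewrite !expr0n scaler0.
      by rewrite exprS [_ *: _]mulrA mulVf ?mul1r ?gt_eqF.
    apply: cvg_within_filter.
    have : {for 0, continuous
        ((fun y : R => y ^+ n.+1) \o (fun h : R => Num.max 0 h))}.
      apply: continuous_comp; last exact: exprn_continuous.
      by apply: continuous_max; [exact: cst_continuous|exact: cvg_id].
    by rewrite /prop_for /continuous_at /= maxxx expr0n.
  apply: DeriveDef; first by apply/cvg_ex; exists 0.
  exact: cvg_lim lim0.
Unshelve. all: by end_near. Qed.

(** * Gradients and Hessians *)

(** Asks for partial derivatives only: the gradient and the Hessian are made of
    those, and partial derivatives at every point suffice for the sum and chain
    rules below. *)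
Definition has_jet2 (R : realType) (n : nat) (c : 'cV[R]_n -> R)
    (G : 'cV[R]_n -> 'cV[R]_n) (H : 'cV[R]_n -> 'M[R]_n) : Prop :=
  (forall x i, is_derive x (delta_mx i 0) c (G x i 0)) /\
  (forall x i j, is_derive x (delta_mx j 0) (fun y => G y i 0) (H x i j)).

Lemma has_jet2_gradient (R : realType) (n : nat) (c : 'cV[R]_n -> R) G H x :
  has_jet2 c G H -> gradient c x = G x.
Proof.
move=> [dc _]; apply/matrixP => i j; rewrite !mxE [j]ord1.
by have [_ ->] := dc x i.
Qed.

Lemma has_jet2_hessian (R : realType) (n : nat) (c : 'cV[R]_n -> R) G H x :
  has_jet2 c G H -> hessian c x = H x.
Proof.
move=> cGH; apply/matrixP => i j; rewrite !mxE.
have -> : (fun y => 'D_(delta_mx i 0) c y) = (fun y => G y i 0).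
  by apply/funext => y; rewrite -(has_jet2_gradient y cGH) mxE.
by have [_ ->] := cGH.2 x i j.
Qed.

Lemma C2_has_jet2 (R : realType) (n : nat) (c : 'cV[R]_n -> R) :
  C2_fun c -> has_jet2 c (gradient c) (hessian c).
Proof.
move=> [dc dG _]; split=> [x i|x i j]; rewrite mxE.
  exact/derivableP/diff_derivable.
rewrite (_ : (fun y => gradient c y i 0) = fun y => 'D_(delta_mx i 0) c y).
  apply: derivableP.
  have /derivable_mxP/(_ i 0) := @diff_derivable _ _ _ _ _ (delta_mx j 0) (dG x).
  by under eq_fun do rewrite mxE.
by apply/funext => y; rewrite mxE.
Qed.

Lemma has_jet2D (R : realType) (n : nat) (a b : 'cV[R]_n -> R) Ga Ha Gb Hb :
  has_jet2 a Ga Ha -> has_jet2 b Gb Hb ->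
  has_jet2 (fun x => a x + b x) (fun x => Ga x + Gb x) (fun x => Ha x + Hb x).
Proof.
move=> [da dGa] [db dGb]; split=> [x i|x i j]; rewrite mxE.
  exact: is_deriveD.
under eq_fun do rewrite mxE.
exact: is_deriveD.
Qed.

Lemma has_jet2_sum (R : realType) (n q : nat) (c : 'I_q -> 'cV[R]_n -> R) G H :
  (forall i, has_jet2 (c i) (G i) (H i)) ->
  has_jet2 (fun x => \sum_i c i x) (fun x => \sum_i G i x)
    (fun x => \sum_i H i x).
Proof.
move=> cGH; split=> [x i|x i j]; rewrite summxE.
  rewrite -(fct_sumE _ _ c).
  by apply: is_derive_sum => k; exact: (cGH k).1.
under eq_fun do rewrite summxE.
rewrite -(fct_sumE _ _ (fun k y => G k y i 0)).
by apply: is_derive_sum => k; exact: (cGH k).2.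
Qed.

(** The rank-one term of the Hessian, weighted by the second derivative of the
    outer function, is where penalties add curvature to the Lagrangian. *)
Lemma has_jet2_comp (R : realType) (n : nat) (c : 'cV[R]_n -> R) G H
    (a a' a'' : R -> R) :
  has_jet2 c G H ->
  (forall t, is_derive t (1 : R) a (a' t)) ->
  (forall t, is_derive t (1 : R) a' (a'' t)) ->
  has_jet2 (a \o c) (fun x => a' (c x) *: G x)
    (fun x => a' (c x) *: H x + a'' (c x) *: (G x *m (G x)^T)).
Proof.
move=> [dc dG] da da'; split=> [x i|x i j]; rewrite !mxE.
  exact: is_derive_comp_real.
under eq_fun do rewrite mxE.
have := is_deriveM (is_derive_comp_real (dc x j) (da' (c x))) (dG x i j).
move=> dM; apply: (is_derive_eq dM).
rewrite big_ord1 !mxE /= /GRing.scale /=; ring.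
Qed.

(** * Quadratic forms *)

Lemma dotvE (R : realType) (n : nat) (u v : 'cV[R]_n) :
  dotv u v = \sum_i u i 0 * v i 0.
Proof. by rewrite /dotv mxE; apply: eq_bigr => i _; rewrite mxE. Qed.

Lemma quad_formD (R : realType) (n : nat) (A B : 'M[R]_n) (d : 'cV[R]_n) :
  quad_form (A + B) d = quad_form A d + quad_form B d.
Proof. by rewrite /quad_form /dotv mulmxDl mulmxDr mxE. Qed.

Lemma quad_form_sum (R : realType) (n q : nat) (A : 'I_q -> 'M[R]_n)
    (d : 'cV[R]_n) :
  quad_form (\sum_i A i) d = \sum_i quad_form (A i) d.
Proof. by rewrite /quad_form /dotv mulmx_suml mulmx_sumr summxE. Qed.

Lemma quad_formZ (R : realType) (n : nat) (a : R) (A : 'M[R]_n)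
    (d : 'cV[R]_n) :
  quad_form (a *: A) d = a * quad_form A d.
Proof. by rewrite /quad_form /dotv -scalemxAl -scalemxAr mxE. Qed.

Lemma quad_form_outer (R : realType) (n : nat) (u d : 'cV[R]_n) :
  quad_form (u *m u^T) d = dotv u d ^+ 2.
Proof.
have dotvC : dotv d u = dotv u d.
  by rewrite !dotvE; apply: eq_bigr => i _; rewrite mulrC.
rewrite /quad_form {1}/dotv -mulmxA mulmxA mxE big_ord1 -/(dotv d u).
by rewrite -/(dotv u d) dotvC expr2.
Qed.

(** * The penalty function and the Lagrangian *)

Definition eq_multiplier (R : realType) (n p : nat)
    (h : 'I_p -> 'cV[R]_n -> R) (rho : R) (x : 'cV[R]_n) : 'cV[R]_p :=
  \col_j (rho * h j x).

Definition ineq_multiplier (R : realType) (n m : nat)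
    (g : 'I_m -> 'cV[R]_n -> R) (rho : R) (x : 'cV[R]_n) : 'cV[R]_m :=
  \col_i (rho * Num.max 0 (g i x) ^+ 3).

(** The Lagrangian is f plus the constraints composed with linear functions, whose
    second derivative is zero; hence no rank-one term. *)
Lemma lagrangian_jet2 (R : realType) (n p m : nat) (f : 'cV[R]_n -> R)
    (h : 'I_p -> 'cV[R]_n -> R) (g : 'I_m -> 'cV[R]_n -> R)
    (mu : 'cV[R]_p) (omega : 'cV[R]_m) :
  C2_fun f -> (forall j, C2_fun (h j)) -> (forall i, C2_fun (g i)) ->
  has_jet2 (fun y => lagrangian f h g y mu omega)
    (fun x => gradient f x + \sum_j mu j 0 *: gradient (h j) x
                           + \sum_i omega i 0 *: gradient (g i) x)
    (fun x => hessian f x + \sum_j mu j 0 *: hessian (h j) x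
                          + \sum_i omega i 0 *: hessian (g i) x).
Proof.
move=> f_C2 h_C2 g_C2.
have linear_jet (q : nat) (c : 'I_q -> 'cV[R]_n -> R) (l : 'cV[R]_q) :
    (forall j, C2_fun (c j)) ->
    has_jet2 (fun x => dotv (cvec c x) l)
      (fun x => \sum_j l j 0 *: gradient (c j) x)
      (fun x => \sum_j l j 0 *: hessian (c j) x).
  move=> c_C2.
  rewrite (_ : (fun x => dotv _ _) = fun x => \sum_j l j 0 * c j x); last first.
    apply/funext => x; rewrite dotvE; apply: eq_bigr => j _.
    by rewrite mxE mulrC.
  apply: has_jet2_sum => j.
  rewrite (_ : (fun x => l j 0 *: hessian (c j) x) = fun x =>
    l j 0 *: hessian (c j) x + 0 *: (gradient (c j) x *m (gradient (c j) x)^T));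
    last by apply/funext => x; rewrite scale0r addr0.
  apply: (has_jet2_comp (C2_has_jet2 (c_C2 j))
    (a := fun t => l j 0 * t)
    (a' := cst (l j 0)) (a'' := cst 0)).
  - move=> t.
    apply: (is_derive_eq (is_deriveZ (f := id) _ _)).
    by rewrite [_%:A]mulr1.
by apply: has_jet2D; [apply: has_jet2D; [exact: C2_has_jet2|]|];
  exact: linear_jet.
Qed.

(** The fourth power makes the inequality penalty twice differentiable: its outer
    function rho/4 max(0, t)^4 has derivatives rho max(0, t)^3 and
    3 rho max(0, t)^2. *)
Lemma penalty_jet2 (R : realType) (n p m : nat) (f : 'cV[R]_n -> R)
    (h : 'I_p -> 'cV[R]_n -> R) (g : 'I_m -> 'cV[R]_n -> R) (rho : R) :
  C2_fun f -> (forall j, C2_fun (h j)) -> (forall i, C2_fun (g i)) ->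
  has_jet2 (penalty f h g rho)
    (fun x => gradient f x + \sum_j (rho * h j x) *: gradient (h j) x
              + \sum_i (rho * Num.max 0 (g i x) ^+ 3) *: gradient (g i) x)
    (fun x => hessian f x
      + \sum_j ((rho * h j x) *: hessian (h j) x
                + rho *: (gradient (h j) x *m (gradient (h j) x)^T))
      + \sum_i ((rho * Num.max 0 (g i x) ^+ 3) *: hessian (g i) x
                + (3 * rho * Num.max 0 (g i x) ^+ 2) *:
                  (gradient (g i) x *m (gradient (g i) x)^T))).
Proof.
move=> f_C2 h_C2 g_C2.
rewrite (_ : penalty f h g rho = fun x =>
    f x + \sum_j (rho / 2 * h j x ^+ 2)
        + \sum_i (rho / 4 * Num.max 0 (g i x) ^+ 4)); last first.
  by apply/funext => x; rewrite /penalty !mulr_sumr.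
apply: has_jet2D; [apply: has_jet2D|].
- exact: C2_has_jet2.
- apply: has_jet2_sum => j.
  apply: (has_jet2_comp (C2_has_jet2 (h_C2 j))
    (a := fun t => rho / 2 * t ^+ 2)
    (a' := fun t => rho * t) (a'' := cst rho)).
  + move=> t.
    have sqr_derive : is_derive t (1 : R) (fun s : R => s ^+ 2) (2 * t).
      split; first exact: exprn_derivable.
      by rewrite exp_derive [LHS]mulr1.
    apply: (is_derive_eq (is_deriveZ _ sqr_derive)).
    rewrite /GRing.scale /=; lra.
  + move=> t; apply: (is_derive_eq (is_deriveZ (f := id) _ _)).
    by rewrite [_%:A]mulr1.
- apply: has_jet2_sum => i.
  apply: (has_jet2_comp (C2_has_jet2 (g_C2 i))
    (a := fun t => rho / 4 * Num.max 0 t ^+ 4)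
    (a' := fun t => rho * Num.max 0 t ^+ 3)
    (a'' := fun t => 3 * rho * Num.max 0 t ^+ 2)).
  + move=> t.
    apply: (is_derive_eq (is_deriveZ _ (is_derive_maxX 2 t))).
    rewrite /GRing.scale /=; lra.
  + move=> t.
    apply: (is_derive_eq (is_deriveZ _ (is_derive_maxX 1 t))).
    rewrite /GRing.scale /=; lra.
Qed.

(** The coefficients rho h_j and rho max(0, g_i)^3 of the constraint Hessians are
    those of the Lagrangian at the multiplier estimates; only the rank-one
    terms remain. *)
Lemma quad_form_penalty (R : realType) (n p m : nat) (f : 'cV[R]_n -> R)
    (h : 'I_p -> 'cV[R]_n -> R) (g : 'I_m -> 'cV[R]_n -> R) (rho : R)
    (x d : 'cV[R]_n) :
  C2_fun f -> (forall j, C2_fun (h j)) -> (forall i, C2_fun (g i)) ->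
  quad_form (hessian (penalty f h g rho) x) d =
  quad_form (hessian (fun y => lagrangian f h g y
    (eq_multiplier h rho x) (ineq_multiplier g rho x)) x) d
  + rho * (\sum_j dotv (gradient (h j) x) d ^+ 2)
  + 3 * rho *
    \sum_i (Num.max 0 (g i x) * dotv (gradient (g i) x) d) ^+ 2.
Proof.
move=> f_C2 h_C2 g_C2.
rewrite (has_jet2_hessian _ (penalty_jet2 rho f_C2 h_C2 g_C2)).
rewrite (has_jet2_hessian _ (lagrangian_jet2 _ _ f_C2 h_C2 g_C2)).
rewrite !quad_formD !quad_form_sum.
have -> : \sum_j quad_form ((rho * h j x) *: hessian (h j) x
      + rho *: (gradient (h j) x *m (gradient (h j) x)^T)) d =
    \sum_j quad_form (eq_multiplier h rho x j 0 *: hessian (h j) x) d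
      + rho * \sum_j dotv (gradient (h j) x) d ^+ 2.
  rewrite mulr_sumr -big_split; apply: eq_bigr => j _.
  by rewrite quad_formD !quad_formZ quad_form_outer mxE.
have -> : \sum_i quad_form ((rho * Num.max 0 (g i x) ^+ 3) *: hessian (g i) x
      + (3 * rho * Num.max 0 (g i x) ^+ 2) *:
        (gradient (g i) x *m (gradient (g i) x)^T)) d =
    \sum_i quad_form (ineq_multiplier g rho x i 0 *: hessian (g i) x) d
      + 3 * rho *
        \sum_i (Num.max 0 (g i x) * dotv (gradient (g i) x) d) ^+ 2.
  rewrite mulr_sumr -big_split; apply: eq_bigr => i _.
  rewrite quad_formD !quad_formZ quad_form_outer mxE /=; ring.
ring.
Qed.

(** If g_i(x) >= 0 the minimum is -g_i(x) because the multiplier is nonnegative;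
    if g_i(x) < 0 the multiplier is zero and so is the minimum. *)
Lemma minv_ineq_multiplier (R : realType) (n m : nat)
    (g : 'I_m -> 'cV[R]_n -> R) (rho : R) (x : 'cV[R]_n) :
  0 <= rho ->
  minv (ineq_multiplier g rho x) (- cvec g x) = - maxv 0 (cvec g x).
Proof.
move=> rho0; apply/matrixP => i j; rewrite !mxE.
have [g0|g0] := leP 0 (g i x).
  by rewrite min_r // (@le_trans _ _ 0) ?oppr_le0 // mulr_ge0 // exprn_ge0.
by rewrite expr0n mulr0 oppr0 min_l // oppr_ge0 ltW.
Qed.

(** * Residuals in the Euclidean norm *)

Lemma enormN (R : realType) (n : nat) (v : 'cV[R]_n) : enorm (- v) = enorm v.
Proof.
rewrite /enorm !dotvE; congr (Num.sqrt _); apply: eq_bigr => i _.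
by rewrite mxE mulrNN.
Qed.

Lemma enorm_le (R : realType) (n : nat) (v : 'cV[R]_n) (r : R) :
  0 <= r -> \sum_i v i 0 ^+ 2 <= r ^+ 2 -> enorm v <= r.
Proof.
move=> r0 vr; rewrite -(ger0_norm r0) -sqrtr_sqr ler_wsqrtr // dotvE.
by under eq_bigr do rewrite -expr2.
Qed.

(** The Euclidean norm is at most the l1 norm, the quantity that the feasibility
    hypothesis controls. *)
Lemma enorm_maxv_le (R : realType) (n : nat) (v : 'cV[R]_n) (r : R) :
  \sum_i Num.max 0 (v i 0) <= r -> enorm (maxv 0 v) <= r.
Proof.
move=> vr.
have max0 i : 0 <= Num.max 0 (v i 0) by rewrite le_max lexx.
have r0 : 0 <= r by apply: le_trans vr; exact: sumr_ge0.
apply: enorm_le => //.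
rewrite expr2.
apply: (@le_trans _ _ ((\sum_i Num.max 0 (v i 0)) * r)); last first.
  exact: ler_wpM2r.
rewrite mulr_suml ler_sum // => i _; rewrite !mxE expr2 ler_wpM2l //.
apply: le_trans vr; rewrite (bigD1 i) //= lerDl sumr_ge0 //.
Qed.

(** * Selecting iterates near the accumulation point *)

Lemma cluster_seq (T : topologicalType) (x : nat -> T) (l : T) (P : set nat)
    (B : set T) :
  cluster (x @ \oo) l -> (\forall k \near \oo, P k) -> nbhs l B ->
  exists2 k, P k & B (x k).
Proof.
move=> xl nP nB; have [|_ [[k Pk <-] Bxk]] := xl (x @` P) B _ nB.
  by apply: filterS nP => k Pk; exists k.
by exists k.
Qed.

(** A constraint with g_i(xbar) > 0 would stay above half that value at iterates
    arbitrarily far along the sequence, against the vanishing of the violations.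
    So an inactive constraint is negative at xbar, and near it by continuity. *)
Lemma inactive_negative_near (R : realType) (n m : nat)
    (g : 'I_m -> 'cV[R]_n -> R) (x : nat -> 'cV[R]_n) (xbar : 'cV[R]_n) :
  (forall i, continuous (g i)) -> cluster (x @ \oo) xbar ->
  \sum_(i < m) Num.max 0 (g i (x k)) @[k --> \oo] --> (0 : R) ->
  \forall y \near xbar, forall i, ~ active g xbar i -> g i y < 0.
Proof.
move=> g_cont x_xbar g_to0.
have FF : Filter (nbhs xbar) by exact: nbhs_filter.
apply: (@filter_forall _ 'I_m
  (fun i y => ~ active g xbar i -> g i y < 0) _ FF) => i.
have [gi0|gi0|gi0] := ltgtP (g i xbar) 0.
- near=> y => _; near: y; exact: (cvgr_lt (g i xbar) (g_cont i xbar)).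
- have gi_near := cvgr_gt (g i xbar) (g_cont i xbar) _ (midf_lt gi0).2.
  have sum_near := cvgr_lt 0 g_to0 _ (midf_lt gi0).1.
  have [k /= sum_lt gi_gt] := cluster_seq x_xbar (sum_near _) (gi_near _).
  have : g i (x k) < g i (x k).
    apply: le_lt_trans (lt_trans sum_lt gi_gt).
    rewrite (bigD1 i) //= (@le_trans _ _ (Num.max 0 (g i (x k)))) //.
      by rewrite le_max lexx orbT.
    by rewrite lerDl sumr_ge0 // => j _; rewrite le_max lexx.
  by rewrite ltxx.
- by near=> y => /(_ gi0).
Unshelve. all: by end_near. Qed.

Unset Implicit Arguments.

Theorem theorem4p2 (R : realType) (n p m : nat) (f : 'cV[R]_n -> R)
    (h : 'I_p -> 'cV[R]_n -> R) (g : 'I_m -> 'cV[R]_n -> R)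
    (f_C2 : C2_fun f)
    (h_C2 : forall j, C2_fun (h j))
    (g_C2 : forall i, C2_fun (g i))
    (x : nat -> 'cV[R]_n)
    (x_method : penalty_method_sequence f h g x)
    (xstar : 'cV[R]_n)
    (xstar_accumulation : cluster (x @ \oo) xstar)
    (h_to0 : \sum_(j < p) h j (x k) ^+ 2 @[k --> \oo] --> (0 : R))
    (g_to0 : \sum_(i < m) Num.max 0 (g i (x k)) @[k --> \oo] --> (0 : R)) :
  Stilde_SAKKT2 f h g xstar.
Proof.
have [eps [rho [[eps_gt0 _ eps_to0] rho_gt0 _ first_order second_order]]] :=
  x_method.
have g_cont i : continuous (g i).
  by move=> y; apply: differentiable_continuous; have [] := g_C2 i.
have inactive_near := inactive_negative_near g_cont xstar_accumulation g_to0.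
have pick l : exists k, [/\ `|xstar - x k| < harmonic l, eps k <= harmonic l,
    enorm (cvec h (x k)) <= harmonic l,
    enorm (maxv 0 (cvec g (x k))) <= harmonic l
  & forall i, ~ active g xstar i -> g i (x k) < 0].
  have dl : 0 < harmonic l :> R := harmonic_gt0 l.
  have [| |k [epsk hk gk] [xk neg]] := @cluster_seq _ x xstar
    (fun k => [/\ eps k <= harmonic l, enorm (cvec h (x k)) <= harmonic l
      & enorm (maxv 0 (cvec g (x k))) <= harmonic l])
    (fun y => `|xstar - y| < harmonic l /\
      forall i, ~ active g xstar i -> g i y < 0) xstar_accumulation.
  - near=> k; split.
    + by near: k; exact: (cvgr_le 0 eps_to0).
    + apply: enorm_le; first exact: ltW.
      under eq_bigr do rewrite mxE.
      by near: k; apply: (cvgr_le 0 h_to0); rewrite exprn_gt0.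
    + apply: enorm_maxv_le.
      under eq_bigr do rewrite mxE.
      by near: k; exact: (cvgr_le 0 g_to0).
  - have xnear : \forall y \near xstar, `|xstar - y| < harmonic l.
      have xid : {for xstar, continuous (@id 'cV[R]_n)} by exact: cvg_id.
      by apply: (cvgr_dist_lt id _ xid).
    exact: (filterI xnear inactive_near).
  - by exists k.
have [s sP] := choice pick.
exists (fun l => x (s l)), (fun l => eq_multiplier h (rho (s l)) (x (s l))),
  (fun l => ineq_multiplier g (rho (s l)) (x (s l))), harmonic.
split; first split.
- move=> l i; rewrite mxE mulr_ge0 ?(ltW (rho_gt0 _)) // exprn_ge0 //.
  by rewrite le_max lexx.
- apply/cvgrPdist_lt => e e0; near=> l.
  have [xl _ _ _ _] := sP l; apply: lt_trans xl _.
  by near: l; exact: (cvgr_lt 0 cvg_harmonic).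
- split; [exact: harmonic_gt0| |exact: cvg_harmonic].
  move=> k l kl; rewrite /harmonic /= lef_pV2 ?posrE ?ltr0n // ler_nat ltnS //.
- move=> l; have [_ epsl hl gl _] := sP l; split=> //.
  + apply: le_trans epsl; apply: le_trans (first_order (s l)).
    rewrite (has_jet2_gradient _ (penalty_jet2 _ f_C2 h_C2 g_C2)) le_eqVlt.
    apply/orP; left; apply/eqP; congr (enorm (_ + _ + _)).
      by apply: eq_bigr => j _; rewrite mxE.
    by apply: eq_bigr => i _; rewrite mxE.
  + by rewrite minv_ineq_multiplier ?enormN // ltW.
- move=> l d [dh dg]; have [_ epsl _ _ neg] := sP l.
  have h_tangent : \sum_j dotv (gradient (h j) (x (s l))) d ^+ 2 = 0.
    by rewrite big1 // => j _; rewrite dh expr0n.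
  have g_tangent : \sum_i (Num.max 0 (g i (x (s l)))
      * dotv (gradient (g i) (x (s l))) d) ^+ 2 = 0.
    rewrite big1 // => i _.
    have [gi|gi] := leP (g i (x (s l))) 0; first by rewrite mul0r expr0n.
    (* g_i > 0 here, so i is active, as inactive constraints are negative at
       this iterate, and its multiplier rho max(0, g_i)^3 is positive *)
    rewrite dg ?mulr0 ?expr0n //.
      by apply: contrapT => /neg; rewrite ltNge => /negP; apply; exact: ltW.
    by rewrite mxE max_r ?(ltW gi) // mulr_gt0 // exprn_gt0.
  have := second_order (s l) d.
  rewrite quad_form_penalty // h_tangent g_tangent !mulr0 !addr0.
  apply: le_trans.
  by rewrite ler_wpM2r ?lerN2 // exprn_ge0 // sqrtr_ge0.
Unshelve. all: by end_near. Qed.
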